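(* For all real $t$, $$I_0(t)^2=\sum_{n=0}^{\infty}\frac{(2n)!}{2^{2n}(n!)^4}\,t^{2n}.$$
   Context: $I_0(t)=\sum_{n=0}^{\infty}\frac{t^{2n}}{2^{2n}(n!)^2}$ denotes the modified Bessel function of the first kind of order $0$. *)

(* Defs.v *)
From Stdlib Require Import Reals Factorial.
From Coquelicot Require Import Coquelicot.

Open Scope R_scope.

(* Modified Bessel function of the first kind of order 0.  [Series] is total;
   the series below converges for every real t, so no default value is used. *)
Definition BesselI0 (t : R) : R :=
  Series (fun n : nat => t ^ (2 * n) / (2 ^ (2 * n) * INR (fact n) ^ 2)).

(* Main.v *)
Require Import Defs.
From Stdlib Require Import ssreflect Reals Factorial Lra Lia.
From Coquelicot Require Import Coquelicot.
From mathcomp Require ssrbool ssrnat seq fintype bigop binomial.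

Open Scope R_scope.

(** Put [x = t^2/4].  Then [I_0(t)] is the sum of [x^n / (n!)^2], an absolutely
    convergent series because it is dominated by the exponential series at [x]
    ([ex_series_Rabs_pow_inv_fact_sqr]).
    Its square is therefore the Cauchy product, whose [n]-th term is
    [x^n * sum_k 1 / (k! (n-k)!)^2 = x^n / (n!)^2 * sum_k (binomial n k)^2].
    The sum of squares is the central binomial coefficient
    [(2n)! / (n!)^2] by Vandermonde's convolution
    ([sum_bin_sqr], [sum_inv_fact_sqr]), and [x^n = t^(2n) / 2^(2n)]
    turns this into the stated term. *)

Section CentralBinomial.

Import ssrbool ssrnat seq fintype bigop binomial.

Lemma factorial_fact (n : nat) : factorial n = Factorial.fact n.
Proof.
  induction n as [|n IH]; [reflexivity|].
  rewrite factS IH mulSn. reflexivity.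
Qed.

Lemma sum_f_R0_big (f : nat -> nat) (n : nat) :
  sum_f_R0 (fun k => INR (f k)) n = INR (\sum_(k < S n) f k)%N.
Proof.
  induction n as [|n IH].
  - rewrite big_ord_recr big_ord0. reflexivity.
  - rewrite big_ord_recr. simpl sum_f_R0. rewrite IH -plus_INR. reflexivity.
Qed.

Lemma INR_bin (n k : nat) :
  (k <= n)%coq_nat ->
  INR 'C(n, k) = INR (fact n) / (INR (fact k) * INR (fact (Nat.sub n k))).
Proof.
  intros Hk.
  assert (H := f_equal INR (bin_fact (introT leP Hk))).
  rewrite !factorial_fact in H.
  change (INR (Nat.mul 'C(n, k) (Nat.mul (fact k) (fact (Nat.sub n k))))
          = INR (fact n)) in H.
  rewrite !mult_INR in H. rewrite -H. field.
  split; apply INR_fact_neq_0.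
Qed.

(** Vandermonde's convolution for [n + n] gives [C(n,k) C(n,n-k)]; symmetry of
    the binomial coefficients makes each term a square. *)
Lemma sum_bin_sqr (n : nat) :
  sum_f_R0 (fun k => INR 'C(n, k) ^ 2) n = INR 'C(Nat.mul 2 n, n).
Proof.
  replace (Nat.mul 2 n) with (addn n n) by (unfold addn; simpl; lia).
  rewrite -Vandermonde -(sum_f_R0_big (fun k => 'C(n, k) * 'C(n, n - k))%N).
  apply sum_eq; intros k Hk.
  rewrite (bin_sub (introT leP Hk)).
  change (INR 'C(n, k) ^ 2 = INR (Nat.mul 'C(n, k) 'C(n, k))).
  rewrite mult_INR. ring.
Qed.

(** The coefficient of [x^n] in the Cauchy square of the series of
    [x^k / (k!)^2]. *)
Lemma sum_inv_fact_sqr (n : nat) :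
  sum_f_R0 (fun k => / INR (fact k) ^ 2 * / INR (fact (n - k)%coq_nat) ^ 2) n
  = INR (fact (2 * n)%coq_nat) / INR (fact n) ^ 4.
Proof.
  assert (Hn := INR_fact_neq_0 n).
  transitivity (/ INR (fact n) ^ 2 * sum_f_R0 (fun k => INR 'C(n, k) ^ 2) n).
  - rewrite scal_sum. apply sum_eq; intros k Hk.
    rewrite (INR_bin n k Hk). field.
    repeat split; try assumption; apply INR_fact_neq_0.
  - rewrite sum_bin_sqr INR_bin; [|lia].
    replace (Nat.sub (Nat.mul 2 n) n) with n by lia.
    field. assumption.
Qed.

End CentralBinomial.

(** Since [n! >= 1], each term is bounded by the term [|x|^n / n!] of the
    series of [exp |x|]. *)
Lemma ex_series_Rabs_pow_inv_fact_sqr (x : R) :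
  ex_series (fun n => Rabs (x ^ n * / INR (fact n) ^ 2)).
Proof.
  apply (ex_series_le (K := R_AbsRing) (V := R_CompleteNormedModule))
    with (b := fun n => Rabs x ^ n * / INR (fact n)).
  - intros n.
    change (Rabs (Rabs (x ^ n * / INR (fact n) ^ 2))
            <= Rabs x ^ n * / INR (fact n)).
    assert (H1 : 1 <= INR (fact n)).
    { apply (le_INR 1). pose proof (lt_O_fact n). lia. }
    rewrite Rabs_Rabsolu Rabs_mult -RPow_abs.
    apply Rmult_le_compat_l; [apply pow_le, Rabs_pos|].
    rewrite Rabs_pos_eq.
    + apply Rinv_le_contravar; nra.
    + left. apply Rinv_0_lt_compat. nra.
  - exists (exp (Rabs x)).
    apply is_series_ext with (2 := is_exp_Reals (Rabs x)).
    intros n. rewrite pow_n_pow. reflexivity.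
Qed.

Theorem mainTheorem11 (t : R) :
  is_series
    (fun n : nat =>
       INR (fact (2 * n)) / (2 ^ (2 * n) * INR (fact n) ^ 4) * t ^ (2 * n))
    (BesselI0 t ^ 2).
Proof.
  set (x := t ^ 2 / 4).
  assert (Hx : forall n, x ^ n = t ^ (2 * n) / 2 ^ (2 * n)).
  { intros n. unfold x. rewrite !pow_mult. unfold Rdiv.
    rewrite Rpow_mult_distr pow_inv. do 3 f_equal. ring. }
  assert (Habs := ex_series_Rabs_pow_inv_fact_sqr x).
  assert (HI : is_series (fun n => x ^ n * / INR (fact n) ^ 2) (BesselI0 t)).
  { unfold BesselI0.
    rewrite (Series_ext _ (fun n => x ^ n * / INR (fact n) ^ 2)).
    - apply Series_correct, ex_series_Rabs, Habs.
    - intros n. rewrite Hx. field.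
      split; [apply INR_fact_neq_0 | apply pow_nonzero; lra]. }
  replace (BesselI0 t ^ 2) with (BesselI0 t * BesselI0 t) by ring.
  apply is_series_ext with (2 := is_series_mult _ _ _ _ HI HI Habs Habs).
  intros n.
  (* The equation lives in the carrier of the normed module; [field] needs R. *)
  match goal with |- ?u = ?v => change (@eq R u v) end.
  transitivity (x ^ n * (INR (fact (2 * n)) / INR (fact n) ^ 4)).
  - rewrite -sum_inv_fact_sqr scal_sum. apply sum_eq; intros k Hk.
    replace (x ^ n) with (x ^ k * x ^ (n - k))
      by (rewrite -pow_add; f_equal; lia).
    ring.
  - rewrite Hx. field.
    split; [apply INR_fact_neq_0 | apply pow_nonzero; lra].
Qed.
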